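(* For every description $\mathtt D$ there exists a description $\mathtt D'$ in reduced form such that $\mathrm{Clo}(\mathtt D)\sim\mathrm{Clo}(\mathtt D')$.
   Context: For $n$-ary Boolean operations $f,g:\{0,1\}^n\to\{0,1\}$: $f\triangleleft g$ means $f(\mathbf a)\le g(\mathbf b)$ for all $\mathbf a\le\mathbf b$ (componentwise); $f^d(\mathbf a)=1-f(\overline{\mathbf a})$, $\overline{\mathbf a}$ the coordinatewise negation. $\mathcal I_k$ is the set of all $k$-tuples $(h_1,\dots,h_k)$ of $n$-ary idempotent Boolean operations ($n\in\mathbb N$ arbitrary, same for all components). A description over a sequence of symbols $(h_1,\dots,h_k)$ is a set of formal constraints each of one of the forms $h_i\triangleleft h_j$, $h_i\triangleleft h_j^d$, $h_i^d\triangleleft h_j$, $h_i^d\triangleleft h_j^d$, $h_i=h_j$, $h_i=h_j^d$, $h_i^d=h_j$, $h_i^d=h_j^d$ ($i,j\in[k]$, not necessarily distinct). $\mathrm{Clo}(\mathtt D)$ is the set of all $(h_1,\dots,h_k)\in\mathcal I_k$ satisfying all constraints of $\mathtt D$; it is a $k$-sorted Boolean clone, regarded as a minion with minors taken componentwise ($h^{(\alpha)}(a_1,\dots,a_m)=h(a_{\alpha(1)},\dots,a_{\alpha(n)})$). A description is in reduced form if it is over symbols $(f_1,\dots,f_n,g_1,\dots,g_m)$ with $n,m\ge0$, $n+m\ge1$, and: (i) $g_i=g_i^d$ is in $\mathtt D$ for every $i\in[m]$; (ii) all other constraints are of the forms $f_i\triangleleft f_j$, $f_i\triangleleft f_j^d$,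 $f_i\triangleleft g_j$, or $g_i\triangleleft g_i$; (iii) there are no $l\ge2$ and pairwise distinct $i_1,\dots,i_l$ with $f_{i_1}\triangleleft f_{i_2},\dots,f_{i_{l-1}}\triangleleft f_{i_l},f_{i_l}\triangleleft f_{i_1}$ all in $\mathtt D$. $\mathcal M\sim\mathcal N$ means there exist minion homomorphisms (arity-preserving maps commuting with taking minors) in both directions. *)

(* Defs.v *)
From HB Require Import structures.
From mathcomp Require Import all_boot.

Set Implicit Arguments.
Unset Strict Implicit.
Unset Printing Implicit Defensive.

Definition op (n : nat) : Type := {ffun {ffun 'I_n -> bool} -> bool}.

Definition le_args n (a b : {ffun 'I_n -> bool}) : bool :=
  [forall i, a i ==> b i].

Definition tri n (f g : op n) : bool :=
  [forall a, forall b, le_args a b ==> (f a ==> g b)].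

Definition dual n (f : op n) : op n :=
  [ffun a : {ffun 'I_n -> bool} => ~~ f [ffun i => ~~ a i]].

(* No nullary operation satisfies this, so the arity 0 part of every clone
   below is empty and including n = 0 among the arities is harmless. *)
Definition idempotent_op n (f : op n) : bool :=
  [forall b : bool, f [ffun=> b] == b].

Definition op_minor n m (alpha : 'I_n -> 'I_m) (f : op n) : op m :=
  [ffun a : {ffun 'I_m -> bool} => f [ffun i => a (alpha i)]].

Record minion := Minion {
  carrier :> nat -> Type;
  minor : forall n m, ('I_n -> 'I_m) -> carrier n -> carrier m;
  minor_id : forall n (x : carrier n), minor id x = x;
  minor_comp : forall n m p (alpha : 'I_n -> 'I_m) (beta : 'I_m -> 'I_p)
    (x : carrier n), minor beta (minor alpha x) = minor (beta \o alpha) x }.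

Definition minion_hom (M N : minion) (phi : forall n, M n -> N n) : Prop :=
  forall n m (alpha : 'I_n -> 'I_m) (x : M n),
    phi m (minor alpha x) = minor alpha (phi n x).

Definition minion_equiv (M N : minion) : Prop :=
  (exists phi : forall n, M n -> N n, minion_hom phi) /\
  (exists psi : forall n, N n -> M n, minion_hom psi).

Inductive literal (k : nat) := Sym of 'I_k | DualSym of 'I_k.

Inductive constraint (k : nat) :=
  | Tri of literal k & literal k
  | Equ of literal k & literal k.

Definition literal_code k (l : literal k) : 'I_k + 'I_k :=
  match l with Sym i => inl i | DualSym i => inr i end.

Definition literal_decode k (c : 'I_k + 'I_k) : literal k :=
  match c with inl i => Sym i | inr i => DualSym i end.

Lemma literal_codeK k : cancel (@literal_code k) (@literal_decode k).
Proof. by case. Qed.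

HB.instance Definition _ k := Finite.copy (literal k)
  (can_type (@literal_codeK k)).

Definition constraint_code k (c : constraint k) :
    (literal k * literal k) + (literal k * literal k) :=
  match c with Tri u v => inl (u, v) | Equ u v => inr (u, v) end.

Definition constraint_decode k
    (c : (literal k * literal k) + (literal k * literal k)) : constraint k :=
  match c with inl (u, v) => Tri u v | inr (u, v) => Equ u v end.

Lemma constraint_codeK k :
  cancel (@constraint_code k) (@constraint_decode k).
Proof. by case. Qed.

HB.instance Definition _ k := Finite.copy (constraint k)
  (can_type (@constraint_codeK k)).

Definition description (k : nat) : Type := {set constraint k}.

Definition eval_literal k n (h : {ffun 'I_k -> op n}) (l : literal k) : op n :=
  match l with Sym i => h i | DualSym i => dual (h i) end.

Definition satisfies k n (h : {ffun 'I_k -> op n}) (c : constraint k) : bool :=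
  match c with
  | Tri u v => tri (eval_literal h u) (eval_literal h v)
  | Equ u v => eval_literal h u == eval_literal h v
  end.

Definition in_clo k (D : description k) n (h : {ffun 'I_k -> op n}) : bool :=
  [forall i, idempotent_op (h i)] && [forall c in D, satisfies h c].

Definition tuple_minor k n m (alpha : 'I_n -> 'I_m) (h : {ffun 'I_k -> op n}) :
  {ffun 'I_k -> op m} := [ffun i => op_minor alpha (h i)].

Lemma tri_minor n m (alpha : 'I_n -> 'I_m) (f g : op n) :
  tri f g -> tri (op_minor alpha f) (op_minor alpha g).
Proof.
move=> /forallP fg; apply/forallP=> a; apply/forallP=> b; apply/implyP=> ab.
rewrite !ffunE; have /forallP/(_ [ffun i => b (alpha i)])/implyP := fg [ffun i => a (alpha i)].
apply; apply/forallP=> i; rewrite !ffunE; exact: (forallP ab).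
Qed.

Lemma dual_minor n m (alpha : 'I_n -> 'I_m) (f : op n) :
  dual (op_minor alpha f) = op_minor alpha (dual f).
Proof.
apply/ffunP=> a; rewrite !ffunE; congr (~~ f _).
by apply/ffunP=> i; rewrite !ffunE.
Qed.

Lemma eval_literal_minor k n m (alpha : 'I_n -> 'I_m)
    (h : {ffun 'I_k -> op n}) (l : literal k) :
  eval_literal (tuple_minor alpha h) l = op_minor alpha (eval_literal h l).
Proof. by case: l => i /=; rewrite ffunE // dual_minor. Qed.

Lemma in_clo_minor k (D : description k) n m (alpha : 'I_n -> 'I_m)
    (h : {ffun 'I_k -> op n}) :
  in_clo D h -> in_clo D (tuple_minor alpha h).
Proof.
case/andP=> /forallP idh /forall_inP Dh; apply/andP; split.
  apply/forallP=> i; apply/forallP=> b; rewrite !ffunE.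
  have /forallP/(_ b)/eqP hb := idh i; apply/eqP; rewrite -[RHS]hb.
  by congr (h i _); apply/ffunP=> j; rewrite !ffunE.
apply/forall_inP=> c /Dh; case: c => u v /=; rewrite !eval_literal_minor.
  exact: tri_minor.
by move/eqP->.
Qed.

Definition clo_carrier k (D : description k) (n : nat) : Type :=
  {h : {ffun 'I_k -> op n} | in_clo D h}.

Definition clo_minor k (D : description k) n m (alpha : 'I_n -> 'I_m)
    (h : clo_carrier D n) : clo_carrier D m :=
  exist _ (tuple_minor alpha (val h)) (in_clo_minor alpha (valP h)).

Lemma clo_minor_id k (D : description k) n (h : clo_carrier D n) :
  clo_minor id h = h.
Proof.
apply: val_inj; apply/ffunP=> i; rewrite ffunE; apply/ffunP=> a; rewrite ffunE.
by congr (val h i _); apply/ffunP=> j; rewrite ffunE.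
Qed.

Lemma clo_minor_comp k (D : description k) n m p (alpha : 'I_n -> 'I_m)
    (beta : 'I_m -> 'I_p) (h : clo_carrier D n) :
  clo_minor beta (clo_minor alpha h) = clo_minor (beta \o alpha) h.
Proof.
apply: val_inj; apply/ffunP=> i; rewrite !ffunE; apply/ffunP=> a.
rewrite !ffunE; congr (val h i _); apply/ffunP=> j; by rewrite !ffunE.
Qed.

Definition Clo k (D : description k) : minion :=
  Minion (@clo_minor_id k D) (@clo_minor_comp k D).

(* Among the n + m symbols, the first n are f_1, ..., f_n and
   the last m are g_1, ..., g_m. *)

Definition fsym n m (i : 'I_n) : literal (n + m) := Sym (lshift m i).
Definition fdual n m (i : 'I_n) : literal (n + m) := DualSym (lshift m i).
Definition gsym n m (j : 'I_m) : literal (n + m) := Sym (rshift n j).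
Definition gdual n m (j : 'I_m) : literal (n + m) := DualSym (rshift n j).

Inductive reduced_constraint n m : constraint (n + m) -> Prop :=
  | RedGSelfDual (j : 'I_m) : reduced_constraint (Equ (gsym n j) (gdual n j))
  | RedFF (i j : 'I_n) : reduced_constraint (Tri (fsym m i) (fsym m j))
  | RedFFd (i j : 'I_n) : reduced_constraint (Tri (fsym m i) (fdual m j))
  | RedFG (i : 'I_n) (j : 'I_m) : reduced_constraint (Tri (fsym m i) (gsym n j))
  | RedGG (j : 'I_m) : reduced_constraint (Tri (gsym n j) (gsym n j)).

Definition reduced_form n m (D : description (n + m)) : Prop :=
  [/\ 0 < n + m,
      forall j : 'I_m, Equ (gsym n j) (gdual n j) \in D,
      forall c, c \in D -> reduced_constraint c
    & forall s : seq 'I_n, 1 < size s -> uniq s ->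
        ~~ cycle (fun i j => Tri (fsym m i) (fsym m j) \in D) s].

(* Main.v *)
(* The constraints generate an implication relation on the 2k literals, closed
   under contraposition, and symbols of a strongly connected component are equal
   in every member of the clone.  Number the components by a key which is
   monotone along implications.  A component with the same key as its dual is
   self-dual and becomes a g; from each other dual pair, the component with the
   smaller key becomes an f.  Monotonicity and contravariance of duality exclude
   all constraints that are not of a reduced shape up to contraposition, and the
   two clones are related by substitution of literals. *)

From mathcomp Require Import all_boot zify.
Require Import Defs.

Set Implicit Arguments.
Unset Strict Implicit.
Unset Printing Implicit Defensive.

(** * Duality and the two comparisons of operations *)

Lemma dualK n : involutive (@dual n).
Proof.
move=> f; apply/ffunP=> a; rewrite !ffunE negbK; congr (f _).
by apply/ffunP=> i; rewrite !ffunE negbK.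
Qed.

Lemma dual_idempotent n (f : op n) : idempotent_op f -> idempotent_op (dual f).
Proof.
move=> /forallP idf; apply/forallP=> b; rewrite ffunE.
rewrite (_ : finfun _ = [ffun=> ~~ b]); first by rewrite (eqP (idf _)) negbK.
by apply/ffunP=> i; rewrite !ffunE.
Qed.

Lemma triP n (f g : op n) :
  reflect (forall a b, le_args a b -> f a -> g b) (tri f g).
Proof.
apply: (iffP forallP) => [fg a b ab fa | fg a].
  by have /forallP/(_ b) := fg a; rewrite ab fa.
by apply/forallP=> b; apply/implyP=> ab; apply/implyP; apply: fg.
Qed.

Lemma le_args_refl n (a : {ffun 'I_n -> bool}) : le_args a a.
Proof. by apply/forallP=> i; apply/implyP. Qed.

(** Equations yield only this pointwise comparison. It is kept apart from [tri], which is not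
    reflexive: [tri f f] says that [f] is monotone. *)
Definition op_le n (f g : op n) : Prop := forall a, f a -> g a.

Lemma tri_op_le n (f g : op n) : tri f g -> op_le f g.
Proof. by move=> /triP fg a; apply: fg (le_args_refl a). Qed.

Lemma op_le_tri n (f f' g' g : op n) :
  op_le f f' -> tri f' g' -> op_le g' g -> tri f g.
Proof.
move=> ff /triP fg gg; apply/triP=> a b ab fa.
exact/gg/(fg a b ab)/ff.
Qed.

Lemma op_le_anti n (f g : op n) : op_le f g -> op_le g f -> f = g.
Proof.
by move=> fg gf; apply/ffunP=> a; apply/idP/idP; [apply: fg | apply: gf].
Qed.

Lemma tri_dual n (f g : op n) : tri f g -> tri (dual g) (dual f).
Proof.
move=> /triP fg; apply/triP=> a b /forallP ab; rewrite !ffunE; apply: contra.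
by apply: fg; apply/forallP=> i; rewrite !ffunE implybNN.
Qed.

(** * Substitution of literals *)

Definition neg k (l : literal k) : literal k :=
  match l with Sym i => DualSym i | DualSym i => Sym i end.

Lemma negK k : involutive (@neg k).
Proof. by case. Qed.

Lemma eval_neg k n (h : {ffun 'I_k -> op n}) (l : literal k) :
  eval_literal h (neg l) = dual (eval_literal h l).
Proof. by case: l => i //=; rewrite dualK. Qed.

Definition subst_literal k k' (t : 'I_k -> literal k') (l : literal k) :=
  match l with Sym i => t i | DualSym i => neg (t i) end.

Lemma subst_neg k k' (t : 'I_k -> literal k') (l : literal k) :
  subst_literal t (neg l) = neg (subst_literal t l).
Proof. by case: l => i //=; rewrite negK. Qed.

Definition pull k k' n (t : 'I_k -> literal k') (h : {ffun 'I_k' -> op n}) :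
  {ffun 'I_k -> op n} := [ffun i => eval_literal h (t i)].

Lemma eval_pull k k' n (t : 'I_k -> literal k') (h : {ffun 'I_k' -> op n}) l :
  eval_literal (pull t h) l = eval_literal h (subst_literal t l).
Proof. by case: l => i /=; rewrite ffunE ?eval_neg. Qed.

Lemma in_cloP k (D : description k) n (h : {ffun 'I_k -> op n}) :
  reflect ((forall i, idempotent_op (h i)) /\ (forall c, c \in D -> satisfies h c))
          (in_clo D h).
Proof.
apply: (iffP andP) => [] [idh Dh]; split.
- exact/forallP.
- by move=> c; apply: (forall_inP Dh).
- exact/forallP.
- exact/forall_inP.
Qed.

(** Evaluation of literals commutes with minors and preserves idempotence, so only the constraints
    of [D] remain to be checked. The homomorphism runs against the direction of [t]. *)
Lemma pull_hom k k' (D : description k) (D' : description k')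
    (t : 'I_k -> literal k') :
  (forall n (h : {ffun 'I_k' -> op n}), in_clo D' h ->
     forall c, c \in D -> satisfies (pull t h) c) ->
  exists phi : forall n, Clo D' n -> Clo D n, minion_hom phi.
Proof.
move=> Dt.
have clo n (h : {ffun 'I_k' -> op n}) : in_clo D' h -> in_clo D (pull t h).
  move=> D'h; apply/in_cloP; split; last exact: Dt.
  have /in_cloP[idh _] := D'h.
  by move=> i; rewrite ffunE; case: (t i) => j //=; apply: dual_idempotent.
exists (fun n (h : Clo D' n) => exist _ (pull t (val h)) (clo n _ (valP h))).
move=> n m alpha h; apply: val_inj; apply/ffunP=> i.
by rewrite /= !ffunE eval_literal_minor.
Qed.

(** * Keys for finite preorders *)

(** Down-sets grow strictly from a class to one strictly above it; incomparable classes with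
    down-sets of equal size are told apart by their representatives. *)
Lemma preorder_key (L : finType) (R : rel L) :
  reflexive R -> transitive R ->
  exists key : L -> nat, (forall u v, R u v -> key u <= key v) /\
                         (forall u v, key u = key v -> R u v).
Proof.
move=> Rxx Rtr; pose E u v := R u v && R v u.
pose rep u := odflt u [pick v | E u v].
have Erep u : E u (rep u).
  by rewrite /rep; case: pickP => //= _; rewrite /E Rxx.
have repE u v : E u v -> rep u = rep v.
  move=> /andP[uv vu]; rewrite /rep.
  rewrite (@eq_pick _ _ (E v)) => [|w].
    by case: pickP => //= /(_ v); rewrite /E Rxx.
  rewrite /E; apply/andP/andP=> [] [x y]; split.
  - exact: Rtr vu x.
  - exact: Rtr y uv.
  - exact: Rtr uv x.
  - exact: Rtr y vu.
pose cnt v := #|[pred w | R w v]|.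
have L0 (u : L) : 0 < #|L| by apply/card_gt0P; exists u.
(* Lexicographic in the size of the down-set and the class representative. *)
exists (fun u => cnt u * #|L| + enum_rank (rep u)); split=> u v.
  move=> uv; have [vu|vu] := boolP (R v u).
    rewrite (repE u v) /E ?uv // leq_add2r leq_mul2r; apply/orP; right.
    by apply: subset_leq_card; apply/subsetP=> w; rewrite !inE => /Rtr; apply.
  have lt_uv: cnt u < cnt v.
    apply: proper_card; apply/properP; split.
      by apply/subsetP=> w; rewrite !inE => /Rtr; apply.
    by exists v; rewrite !inE.
  apply: leq_trans (leq_addr _ _); apply: leq_trans (_ : (cnt u).+1 * #|L| <= _).
    by rewrite mulSn addnC leq_add2r ltnW.
  by rewrite leq_mul2r lt_uv orbT.
(* Ranks are below [#|L|], so the remainder recovers the rank of the representative. *)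
move/(congr1 (modn^~ #|L|)); rewrite !modnMDl !modn_small //.
move/val_inj/enum_rank_inj => ruv.
have /andP[u1 _] := Erep u; have /andP[_ v2] := Erep v.
by apply: Rtr v2; rewrite -ruv.
Qed.

(** * Implications between literals *)

Section Reduction.

Variables (k : nat) (D : description k).

Implicit Types u v w : literal k.

Definition strict_step u v := (Tri u v \in D) || (Tri (neg v) (neg u) \in D).

Definition weak_step u v :=
  [|| strict_step u v, Equ u v \in D, Equ v u \in D,
      Equ (neg u) (neg v) \in D | Equ (neg v) (neg u) \in D].

Definition weak := connect weak_step.

(** A path with at least one triangle among its steps. This suffices for [tri], which absorbs
    pointwise comparisons on both sides; a [weak] path may be empty or use equations only. *)
Definition strict u v :=
  [exists u', exists v', [&& weak u u', strict_step u' v' & weak v' v]].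

Lemma strictP u v :
  reflect (exists u' v', [/\ weak u u', strict_step u' v' & weak v' v])
          (strict u v).
Proof.
apply: (iffP existsP) => [[u' /existsP[v' /and3P uv]]|[u' [v' uv]]].
  by exists u', v'.
by exists u'; apply/existsP; exists v'; apply/and3P.
Qed.

Lemma strict_step_neg u v : strict_step (neg v) (neg u) = strict_step u v.
Proof. by rewrite /strict_step !negK orbC. Qed.

Lemma weak_step_neg u v : weak_step (neg v) (neg u) = weak_step u v.
Proof.
rewrite /weak_step strict_step_neg !negK; congr (_ || _).
by do 4 case: (_ \in D).
Qed.

Lemma weak_neg u v : weak u v -> weak (neg v) (neg u).
Proof.
move=> /connectP[p]; elim: p u => [|w p IHp] u /=.
  by move=> _ ->; apply: connect0.
move=> /andP[uw wp] pv; apply: connect_trans (IHp w wp pv) (connect1 _).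
by rewrite weak_step_neg.
Qed.

Lemma strict_neg u v : strict u v -> strict (neg v) (neg u).
Proof.
move=> /strictP[u' [v' [uu st vv]]]; apply/strictP; exists (neg v'), (neg u').
by split; rewrite ?weak_neg ?strict_step_neg.
Qed.

Lemma strict_weak u v : strict u v -> weak u v.
Proof.
move=> /strictP[u' [v' [uu st vv]]].
apply: connect_trans uu (connect_trans (connect1 _) vv).
by rewrite /weak_step st.
Qed.

Lemma strict_weak_trans u u' v' v :
  weak u u' -> strict u' v' -> weak v' v -> strict u v.
Proof.
move=> uu /strictP[x [y [ux xy yv]]] vv; apply/strictP; exists x, y.
by split; [apply: connect_trans uu ux | | apply: connect_trans yv vv].
Qed.

Section Soundness.

Variables (n : nat) (h : {ffun 'I_k -> op n}).
Hypothesis Dh : in_clo D h.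

Lemma strict_step_sound u v :
  strict_step u v -> tri (eval_literal h u) (eval_literal h v).
Proof.
have /in_cloP[_ hD] := Dh.
case/orP => /hD //= /tri_dual; by rewrite !eval_neg !dualK.
Qed.

Lemma weak_step_sound u v :
  weak_step u v -> op_le (eval_literal h u) (eval_literal h v).
Proof.
have /in_cloP[_ hD] := Dh.
case/or4P => [/strict_step_sound/tri_op_le // | /hD /eqP -> // | /hD /eqP -> // |].
by case/orP => /hD /eqP; rewrite !eval_neg => /(can_inj (@dualK _)) ->.
Qed.

Lemma weak_sound u v :
  weak u v -> op_le (eval_literal h u) (eval_literal h v).
Proof.
move=> /connectP[p]; elim: p u => [|w p IHp] u /=; first by move=> _ ->.
by move=> /andP[/weak_step_sound uw wp] pv a /uw; apply: IHp.
Qed.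

Lemma strict_sound u v :
  strict u v -> tri (eval_literal h u) (eval_literal h v).
Proof.
move=> /strictP[u' [v' [/weak_sound uu /strict_step_sound st /weak_sound vv]]].
exact: op_le_tri uu st vv.
Qed.

End Soundness.

(** * Components and their names as f's and g's *)

Variable key : literal k -> nat.
Hypothesis key_mono : forall u v, weak u v -> key u <= key v.
Hypothesis key_weak : forall u v, key u = key v -> weak u v.

(** Equal keys amount to implications both ways, which contraposition preserves; hence [neg] acts on
    components. *)
Lemma key_neg u v : key u = key v -> key (neg u) = key (neg v).
Proof.
move=> uv; apply/eqP; rewrite eqn_leq.
by rewrite !key_mono // weak_neg // key_weak.
Qed.

Definition rep u := odflt u [pick v | key v == key u].

Lemma key_rep u : key (rep u) = key u.
Proof. by rewrite /rep; case: pickP => //= v /eqP. Qed.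

Lemma eq_rep u v : key u = key v -> rep u = rep v.
Proof.
move=> uv; rewrite /rep uv.
(* [v] itself has the required key, so the differing defaults are never reached. *)
by case: pickP => //= /(_ v); rewrite eqxx.
Qed.

(* As [key] is monotone along [weak] and [weak] is contravariant under [neg],
   the literals below their dual form a down-set; those become the f's. *)
Definition fset := [set u | (key u < key (neg u)) && (rep u == u)].
Definition gset := [set u | (key u == key (neg u)) && (rep u == u)].

Local Notation N := #|fset|.
Local Notation M := #|gset|.

Definition base (i : 'I_(N + M)) : literal k :=
  match split i with inl i => enum_val i | inr j => enum_val j end.

Definition back : literal (N + M) -> literal k := subst_literal base.

Lemma back_neg x : back (neg x) = neg (back x).
Proof. exact: subst_neg. Qed.

Lemma back_fsym (i : 'I_N) : back (fsym M i) = enum_val i.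
Proof. by rewrite /= /base (unsplitK (inl i)). Qed.

Lemma back_gsym (j : 'I_M) : back (gsym N j) = enum_val j.
Proof. by rewrite /= /base (unsplitK (inr j)). Qed.

Lemma fsym_low (i : 'I_N) : key (enum_val i) < key (neg (enum_val i)).
Proof. by have := enum_valP i; rewrite inE => /andP[]. Qed.

Lemma gsym_self (j : 'I_M) : key (enum_val j) = key (neg (enum_val j)).
Proof. by have := enum_valP j; rewrite inE => /andP[/eqP]. Qed.

Lemma fsym_inj (i j : 'I_N) : key (enum_val i) = key (enum_val j) -> i = j.
Proof.
move/eq_rep; have := enum_valP i; have := enum_valP j.
by rewrite !inE => /andP[_ /eqP->] /andP[_ /eqP->] /enum_val_inj.
Qed.

Lemma gsym_inj (i j : 'I_M) : key (enum_val i) = key (enum_val j) -> i = j.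
Proof.
move/eq_rep; have := enum_valP i; have := enum_valP j.
by rewrite !inE => /andP[_ /eqP->] /andP[_ /eqP->] /enum_val_inj.
Qed.

(** Duals are written with [neg] so that [back_neg] and [eval_neg] can rewrite them. *)
Variant literal_spec : literal (N + M) -> Type :=
  | LitF i : literal_spec (fsym M i)
  | LitFd i : literal_spec (neg (fsym M i))
  | LitG j : literal_spec (gsym N j)
  | LitGd j : literal_spec (neg (gsym N j)).

Lemma literalP x : literal_spec x.
Proof.
case: x => i; rewrite -(splitK i); case: (split i) => j;
  [exact: LitF | exact: LitG | exact: LitFd | exact: LitGd].
Qed.

Lemma rep_idem u : rep (rep u) == rep u.
Proof. by rewrite (eq_rep (key_rep u)). Qed.

Lemma back_surj u : exists x, key (back x) = key u.
Proof.
have low v : key v < key (neg v) -> exists i : 'I_N, key (enum_val i) = key v.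
  move=> lv; have repF : rep v \in fset.
    by rewrite inE rep_idem key_rep (key_neg (key_rep v)) lv.
  by exists (enum_rank_in repF (rep v)); rewrite enum_rankK_in // key_rep.
case: (ltngtP (key u) (key (neg u))) => lu.
- by have [i <-] := low u lu; exists (fsym M i); rewrite back_fsym.
(* A component above its dual is named by the dual of an f. *)
- have /low[i ki] : key (neg u) < key (neg (neg u)) by rewrite negK.
  exists (fdual M i); rewrite -[fdual M i]/(neg (fsym M i)) back_neg back_fsym.
  by rewrite (key_neg ki) negK.
- have repG : rep u \in gset.
    by rewrite inE rep_idem key_rep (key_neg (key_rep u)) lu eqxx.
  exists (gsym N (enum_rank_in repG (rep u))).
  by rewrite back_gsym enum_rankK_in // key_rep.
Qed.

(** * The reduced description *)

(** All [strict] consequences of admissible shape are taken, since a constraint of [D] may mention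
    any literal of a component, not just its representative. *)
Definition reduced_desc : description (N + M) := [set c |
  [|| [exists j, c == Equ (gsym N j) (gdual N j)],
      [exists i, exists j, (c == Tri (fsym M i) (fsym M j)) &&
         strict (back (fsym M i)) (back (fsym M j))],
      [exists i, exists j, (c == Tri (fsym M i) (fdual M j)) &&
         strict (back (fsym M i)) (back (fdual M j))],
      [exists i, exists j, (c == Tri (fsym M i) (gsym N j)) &&
         strict (back (fsym M i)) (back (gsym N j))] |
      [exists j, (c == Tri (gsym N j) (gsym N j)) &&
         strict (back (gsym N j)) (back (gsym N j))]]].

Lemma reduced_descP c :
  reflect (reduced_constraint c /\
           (if c is Tri x y then strict (back x) (back y) : Prop else True))
          (c \in reduced_desc).
Proof.
rewrite inE; apply: (iffP idP).
  case/or4P => [/existsP[j /eqP->] | | | /orP[]].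
  - by split=> //; apply: RedGSelfDual.
  - by move=> /existsP[i /existsP[j /andP[/eqP-> st]]]; split=> //; apply: RedFF.
  - by move=> /existsP[i /existsP[j /andP[/eqP-> st]]]; split=> //; apply: RedFFd.
  - by move=> /existsP[i /existsP[j /andP[/eqP-> st]]]; split=> //; apply: RedFG.
  - by move=> /existsP[j /andP[/eqP-> st]]; split=> //; apply: RedGG.
case=> [[j | i j | i j | i j | j]] st; apply/or4P.
- by apply: Or41; apply/existsP; exists j.
- by apply: Or42; apply/existsP; exists i; apply/existsP; exists j; rewrite eqxx.
- by apply: Or43; apply/existsP; exists i; apply/existsP; exists j; rewrite eqxx.
- apply: Or44; apply/orP; left.
  by apply/existsP; exists i; apply/existsP; exists j; rewrite eqxx.
- by apply: Or44; apply/orP; right; apply/existsP; exists j; rewrite eqxx.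
Qed.

Lemma reduced_desc_reduced : 0 < k -> reduced_form reduced_desc.
Proof.
move=> k0; split.
- have [x _] := back_surj (Sym (Ordinal k0)).
  by case: x => i; apply: leq_ltn_trans (ltn_ord i).
- by move=> j; apply/reduced_descP; split=> //; apply: RedGSelfDual.
- by move=> c /reduced_descP[].
- move=> s s2 Us; apply/negP => cs.
  case: s s2 Us cs => [|i [|j s]] // _ Us cs.
  have sub : subrel (connect (fun i j => Tri (fsym M i) (fsym M j) \in reduced_desc))
                    (fun i j => weak (back (fsym M i)) (back (fsym M j))).
    move=> x _ /connectP[p + ->]; elim: p x => [|y p IHp] x /=.
      by move=> _; apply: connect0.
    move=> /andP[/reduced_descP[_ /strict_weak xy] /IHp]; exact: connect_trans.
  have cyc := connect_cycle cs.
  (* Neighbours on a cycle imply each other, so they share a key, while distinct f's have distinct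
     keys. *)
  have ij : i = j.
    apply/fsym_inj/eqP; rewrite -!back_fsym eqn_leq.
    by rewrite !key_mono //; apply/sub/cyc; rewrite !inE eqxx ?orbT.
  by move: Us; rewrite ij /= inE eqxx.
Qed.

(** * The two homomorphisms *)

Lemma Clo_to_reduced n (h : {ffun 'I_k -> op n}) : in_clo D h ->
  forall c, c \in reduced_desc -> satisfies (pull base h) c.
Proof.
move=> Dh [x y|x y] /reduced_descP[red st] /=; rewrite !eval_pull.
  exact: (strict_sound Dh).
case xy : _ / red => [j||||] //; case: xy => -> ->.
(* A g and its dual share a key, so they bound each other pointwise. *)
rewrite -/(back _) -/(back (gdual N j)) -[gdual N j]/(neg (gsym N j)).
rewrite back_neg back_gsym; apply/eqP/op_le_anti; apply: (weak_sound Dh).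
  exact/key_weak/gsym_self.
exact/key_weak/esym/gsym_self.
Qed.

Section Back.

Variables (n : nat) (h : {ffun 'I_(N + M) -> op n}).
Hypothesis Dh : in_clo reduced_desc h.

Lemma dual_gsym j : dual (eval_literal h (gsym N j)) = eval_literal h (gsym N j).
Proof.
have /in_cloP[_ hD] := Dh; apply/eqP; rewrite eq_sym.
apply: (hD (Equ (gsym N j) (gdual N j))); apply/reduced_descP.
by split=> //; apply: RedGSelfDual.
Qed.

(** A component has only one name, except that a g and its dual name the same one, and these
    evaluate alike by self-duality. *)
Lemma eval_key x y :
  key (back x) = key (back y) -> eval_literal h x = eval_literal h y.
Proof.
move=> kxy; have := key_neg kxy; move: kxy.
case: (literalP x) => i; case: (literalP y) => j;
  rewrite ?eval_neg ?dual_gsym // ?back_neg ?negK ?back_fsym ?back_gsym => kij nij;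
  (* The key inequalities refute every pair of names of different kinds: f, dual of an f, or g up to
     duality. *)
  try (have := fsym_low i); try (have := fsym_low j);
  try (have := gsym_self i); try (have := gsym_self j); try lia.
- by move=> _ _; rewrite (fsym_inj kij).
- by move=> _ _; rewrite (fsym_inj nij).
- by move=> _ _; rewrite (gsym_inj kij).
- by move=> gj gi; rewrite (@gsym_inj i j) //; lia.
- by move=> gj gi; rewrite (@gsym_inj i j) //; lia.
- by move=> gj gi; rewrite (@gsym_inj i j) //; lia.
Qed.

Lemma reduced_strict x y : reduced_constraint (Tri x y) ->
  strict (back x) (back y) -> tri (eval_literal h x) (eval_literal h y).
Proof.
move=> red st; have /in_cloP[_ hD] := Dh.
by apply: (hD (Tri x y)); apply/reduced_descP.
Qed.

Lemma literal_key x :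
  [\/ exists i, key (back x) = key (back (fsym M i)),
      exists i, key (back x) = key (back (neg (fsym M i))) |
      exists j, key (back x) = key (back (gsym N j))].
Proof.
case: (literalP x) => i; [apply: Or31|apply: Or32|apply: Or33|apply: Or33];
  exists i => //.
by rewrite back_neg back_gsym -gsym_self.
Qed.

(** Of the nine pairs of kinds, three are impossible, four have a reduced shape and two are
    contrapositives of such shapes. *)
Lemma strict_eval x y :
  strict (back x) (back y) -> tri (eval_literal h x) (eval_literal h y).
Proof.
case: (literal_key x) (literal_key y) => [][i kx] [][j ky];
  rewrite (eval_key kx) (eval_key ky) =>
    /(strict_weak_trans (key_weak (esym kx)))/(_ (key_weak ky)) {kx ky} st;
  (* Monotonicity along [st] and its contrapositive excludes implications from a dual f to an f or a
     g, and from a g to an f. *)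
  have := key_mono (strict_weak st);
  have := key_mono (strict_weak (strict_neg st));
  move: st; rewrite !(back_neg, back_fsym, back_gsym, negK) => st le1 le2;
  try (have lowi := fsym_low i); try (have lowj := fsym_low j);
  try (have selfi := gsym_self i); try (have selfj := gsym_self j); try lia.
- by apply: reduced_strict; [apply: RedFF | rewrite !back_fsym].
- by apply: reduced_strict; [apply: RedFFd | rewrite back_neg !back_fsym].
- by apply: reduced_strict; [apply: RedFG | rewrite back_fsym back_gsym].
- rewrite !eval_neg; apply: tri_dual; apply: reduced_strict; first exact: RedFF.
  rewrite !back_fsym -[X in strict X]negK -[X in strict _ X]negK.
  exact: strict_neg.
(* As g equals its dual, g below a dual f is the contrapositive of f below g. *)
- rewrite eval_neg -dual_gsym; apply: tri_dual.
  apply: reduced_strict; first exact: RedFG.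
  rewrite back_fsym back_gsym.
  apply: strict_weak_trans (connect0 _ _) _ (key_weak (esym selfi)).
  by rewrite -[X in strict X]negK; apply: strict_neg.
(* For two g's the inequalities are opposite, forcing equal keys. *)
- have ij : i = j by apply: gsym_inj; lia.
  by subst j; apply: reduced_strict; [apply: RedGG | rewrite !back_gsym].
Qed.

End Back.

(** Any choice [t] of names works: a triangle of [D] becomes a [strict] pair of names, and an
    equation joins literals of equal key, to which [eval_key] applies. *)
Lemma reduced_to_Clo (t : 'I_k -> literal (N + M)) :
  (forall i, key (back (t i)) = key (Sym i)) ->
  forall n (h : {ffun 'I_(N + M) -> op n}), in_clo reduced_desc h ->
  forall c, c \in D -> satisfies (pull t h) c.
Proof.
move=> tE n h Dh.
have keyt l : key (back (subst_literal t l)) = key l.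
  case: l => i /=; first exact: tE.
  by rewrite back_neg (key_neg (tE i)).
case=> u v uvD /=; rewrite !eval_pull.
  apply: strict_eval => //.
  apply: strict_weak_trans (key_weak (keyt u)) _ (key_weak (esym (keyt v))).
  apply/strictP; exists u, v; split; [exact: connect0 | | exact: connect0].
  by rewrite /strict_step uvD.
apply/eqP/eval_key => //; rewrite !keyt; apply/eqP; rewrite eqn_leq.
by rewrite !key_mono //; apply: connect1; rewrite /weak_step uvD ?orbT.
Qed.

End Reduction.

Theorem theorem4p11 (k : nat) (hk : 0 < k) (D : description k) :
  exists (n m : nat) (D' : description (n + m)),
    reduced_form D' /\ minion_equiv (Clo D) (Clo D').
Proof.
have [key [key_mono key_weak]] :=
  preorder_key (@connect0 _ (weak_step D)) (@connect_trans _ (weak_step D)).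
exists #|fset key|, #|gset key|, (reduced_desc D key).
split; first exact: reduced_desc_reduced.
(* Every component has a name, so one can be chosen for each symbol. *)
have [t tE] := fin_all_exists (fun i => back_surj key_mono key_weak (Sym i)).
split; first exact: pull_hom (Clo_to_reduced key_weak).
exact: pull_hom (reduced_to_Clo key_mono key_weak tE).
Qed.
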